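(* Let $\delta t>0$ and let $\mathbf{a}^{n-1},\mathbf{a}^n\in\mathbb{R}^{2r}$ be given. Consider the BDF2 scheme that determines $\mathbf{a}^{n+1}\in\mathbb{R}^{2r}$ from $$\mathbf{U}^T\mathcal{L}_h^{*}\mathbf{U}\,\frac{3\mathbf{a}^{n+1}-4\mathbf{a}^n+\mathbf{a}^{n-1}}{2\delta t}=-\mathbf{U}^T\mathcal{L}_h^{*}\,\mathcal{N}_h\big(\mathbf{U}\overline{\mathbf{a}}^{n+1}\big)\,\mathcal{L}_h\big[\mathbf{U}\mathbf{a}^{n+1}\big],$$ where $\overline{\mathbf{a}}^{n+1}=2\mathbf{a}^n-\mathbf{a}^{n-1}$. This scheme is linear (i.e. it is a linear system of equations for the unknown $\mathbf{a}^{n+1}$), and its solution satisfies the discrete energy dissipation law $$\hat{\mathcal{E}}_r(\mathbf{U}\mathbf{a}^{n+1},\mathbf{U}\mathbf{a}^n)-\hat{\mathcal{E}}_r(\mathbf{U}\mathbf{a}^n,\mathbf{U}\mathbf{a}^{n-1})\le-\delta t\,\Big(\mathcal{L}_h[\mathbf{U}\mathbf{a}^{n+1}]\Big)^T\mathcal{N}_h\big(\mathbf{U}\overline{\mathbf{a}}^{n+1}\big)\Big(\mathcal{L}_h[\mathbf{U}\mathbf{a}^{n+1}]\Big),$$ where the modified discrete free energy is $$\hat{\mathcal{E}}_r(\mathbf{U}\mathbf{a}_1,\mathbf{U}\mathbf{a}_2)=\frac14[\mathbf{U}\mathbf{a}_1]^T\mathcal{L}_h[\mathbf{U}\mathbf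{a}_1]+\frac14[\mathbf{U}(2\mathbf{a}_1-\mathbf{a}_2)]^T\mathcal{L}_h[\mathbf{U}(2\mathbf{a}_1-\mathbf{a}_2)].$$
   Context: Setting (spatially discretized, energy-quadratized system). Let $N\ge 1$ be the number of spatial grid points and $1\le r\le N$. The full discrete state is $\Psi=\begin{bmatrix}\phi\\ q\end{bmatrix}\in\mathbb{R}^{2N}$ with $\phi,q\in\mathbb{R}^N$. Linear operator: $\mathcal{L}_h=\begin{bmatrix}\mathcal{L}_{0,h}&0\\0&\mathbf{I}_N\end{bmatrix}$, where $\mathcal{L}_{0,h}\in\mathbb{R}^{N\times N}$ is symmetric, positive semi-definite and invertible (hence positive definite); $\mathcal{L}_h^{*}=\mathcal{L}_h^T$ denotes its adjoint. Mobility: $\mathcal{N}_h(\Psi)=\mathcal{N}_0(\Psi)^T(\mathcal{G}_a+\mathcal{G}_s)\mathcal{N}_0(\Psi)\in\mathbb{R}^{2N\times 2N}$, where $\mathcal{G}_a\in\mathbb{R}^{N\times N}$ is skew-symmetric, $\mathcal{G}_s\in\mathbb{R}^{N\times N}$ is symmetric positive semi-definite, and $\mathcal{N}_0(\Psi)=\begin{bmatrix}\mathbf{I}_N & \mathrm{diag}(g(\phi))\end{bmatrix}\in\mathbb{R}^{N\times 2N}$ with $g:\mathbb{R}\to\mathbb{R}$ a given function applied componentwise to $\phi$. Reduced basis: $\mathbf{U}=\begin{bmatrix}\mathbf{U}_\phi&0\\0&\mathbf{U}_q\end{bmatrix}\in\mathbb{R}^{2N\times 2r}$, where $\mathbf{U}_\phi,\mathbf{U}_q\in\mathbb{R}^{N\times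 r}$ have orthonormal columns (leading left singular vectors of snapshot matrices), so $\mathbf{U}^T\mathbf{U}=\mathbf{I}_{2r}$. The reduced unknowns are $\mathbf{a}^k=\begin{bmatrix}\mathbf{a}_\phi^k\\ \mathbf{a}_q^k\end{bmatrix}\in\mathbb{R}^{2r}$, where the superscript $k$ is the time-step index. *)

(* Defs.v *)
From mathcomp Require Import all_boot all_order all_algebra.
From mathcomp Require Import reals.

Set Implicit Arguments.
Unset Strict Implicit.
Unset Printing Implicit Defensive.

Import Order.TTheory GRing.Theory Num.Theory.
Local Open Scope ring_scope.

Section Defs.
Variable R : realType.

Definition qform n (A : 'M[R]_n) (x : 'cV[R]_n) : R := (x^T *m A *m x) 0 0.

(* Nonnegativity of the quadratic form only: symmetry is always required
   separately, through [symmetricmx]. *)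
Definition nonneg_qform n (A : 'M[R]_n) : Prop :=
  forall x : 'cV[R]_n, 0 <= qform A x.

Section System.
Variables (N r : nat).

Definition Lh (L0 : 'M[R]_N) : 'M[R]_(N + N) := block_mx L0 0 0 1%:M.

(* A state is [col_mx phi q]; only its upper half phi enters the mobility.
   The transposition is there because [diag_mx] takes a row vector. *)
Definition N0 (g : R -> R) (Psi : 'cV[R]_(N + N)) : 'M[R]_(N, N + N) :=
  row_mx 1%:M (diag_mx (map_mx g (usubmx Psi))^T).

Definition Nh (g : R -> R) (Ga Gs : 'M[R]_N) (Psi : 'cV[R]_(N + N)) :
    'M[R]_(N + N) :=
  (N0 g Psi)^T *m (Ga + Gs) *m N0 g Psi.

Definition basis (Uphi Uq : 'M[R]_(N, r)) : 'M[R]_(N + N, r + r) :=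
  block_mx Uphi 0 0 Uq.

Definition extrapolate (an aprev : 'cV[R]_(r + r)) : 'cV[R]_(r + r) :=
  2 *: an - aprev.

Definition bdf2_lhs (L0 : 'M[R]_N) (Uphi Uq : 'M[R]_(N, r)) (dt : R)
    (aprev an anext : 'cV[R]_(r + r)) : 'cV[R]_(r + r) :=
  let U := basis Uphi Uq in
  U^T *m (Lh L0)^T *m U *m ((2 * dt)^-1 *: (3 *: anext - 4 *: an + aprev)).

Definition bdf2_rhs (L0 Ga Gs : 'M[R]_N) (g : R -> R)
    (Uphi Uq : 'M[R]_(N, r)) (aprev an anext : 'cV[R]_(r + r)) :
    'cV[R]_(r + r) :=
  let U := basis Uphi Uq in
  - (U^T *m (Lh L0)^T *m Nh g Ga Gs (U *m extrapolate an aprev)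
       *m (Lh L0 *m (U *m anext))).

Definition bdf2_energy (L0 : 'M[R]_N) (Uphi Uq : 'M[R]_(N, r))
    (a1 a2 : 'cV[R]_(r + r)) : R :=
  let U := basis Uphi Uq in
  4^-1 * qform (Lh L0) (U *m a1)
  + 4^-1 * qform (Lh L0) (U *m (2 *: a1 - a2)).

End System.

(* The equation [lhs x = rhs x] is the linear system [A x = b]: the two
   residuals coincide at every x, not merely the two solution sets. *)
Definition linear_system m n (lhs rhs : 'cV[R]_n -> 'cV[R]_m) : Prop :=
  exists (A : 'M[R]_(m, n)) (b : 'cV[R]_m),
    forall x, lhs x - rhs x = A *m x - b.

End Defs.

(* Main.v *)
(* In the L_h-inner product, 2 (3 x - 4 y + z, x) equals |x|^2 + |2x - y|^2
   - |y|^2 - |2y - z|^2 + |x - 2y + z|^2 (the G-stability of BDF2).  Testing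
   the scheme with a^{n+1} therefore gives the energy law with equality, up to
   the nonnegative term |x - 2y + z|^2, where x, y, z are the lifts U a^{n+1},
   U a^n, U a^{n-1}. *)
Require Import Defs.
From mathcomp Require Import all_boot all_order all_algebra.
From mathcomp Require Import reals.
From mathcomp Require Import ring lra.

Set Implicit Arguments.
Unset Strict Implicit.
Unset Printing Implicit Defensive.

Import Order.TTheory GRing.Theory Num.Theory.
Local Open Scope ring_scope.

Section SymmetricForm.
Variables (R : realType) (n : nat) (A : 'M[R]_n).

(** The polar form of [qform], needed for the cross terms between time levels. *)
Definition bform (x y : 'cV[R]_n) : R := (x^T *m A *m y) 0 0.

Lemma bformDl x y z : bform (x + y) z = bform x z + bform y z.
Proof. by rewrite /bform linearD !mulmxDl mxE. Qed.

Lemma bformDr x y z : bform x (y + z) = bform x y + bform x z.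
Proof. by rewrite /bform mulmxDr mxE. Qed.

Lemma bformZl c x y : bform (c *: x) y = c * bform x y.
Proof. by rewrite /bform linearZ -!scalemxAl mxE. Qed.

Lemma bformZr c x y : bform x (c *: y) = c * bform x y.
Proof. by rewrite /bform -scalemxAr mxE. Qed.

Lemma bformNl x y : bform (- x) y = - bform x y.
Proof. by rewrite -scaleN1r bformZl mulN1r. Qed.

Lemma bformNr x y : bform x (- y) = - bform x y.
Proof. by rewrite -scaleN1r bformZr mulN1r. Qed.

Lemma bform_sym : A^T = A -> forall x y, bform x y = bform y x.
Proof.
move=> symA x y.
have -> : bform x y = (x^T *m A *m y)^T 0 0 by rewrite mxE.
by rewrite !trmx_mul trmxK symA mulmxA.
Qed.

Lemma bdf2_polarization : A^T = A -> forall x y z,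
  4^-1 * qform A x + 4^-1 * qform A (2 *: x - y)
    - (4^-1 * qform A y + 4^-1 * qform A (2 *: y - z))
  = 2^-1 * bform x (3 *: x - 4 *: y + z) - 4^-1 * qform A (x - 2 *: y + z).
Proof.
move=> symA x y z; have qE u : qform A u = bform u u by [].
rewrite !qE !(bformDl, bformDr, bformNl, bformNr, bformZl, bformZr).
(* Symmetry puts the cross terms in a single order, leaving six scalars as atoms; what remains is a
   polynomial identity in them. *)
rewrite (bform_sym symA y x) (bform_sym symA z x) (bform_sym symA z y).
by field.
Qed.

End SymmetricForm.

Section LhFacts.
Variables (R : realType) (N : nat) (L0 : 'M[R]_N).

Lemma Lh_sym : L0 \is symmetricmx -> (Lh L0)^T = Lh L0.
Proof.
(* [symmetricmx] is the hermitian predicate with sign exponent 0 and trivial conjugation. *)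
move=> /is_hermitianmxP; rewrite expr0 scale1r map_mx_id // => symL0.
by rewrite /Lh tr_block_mx !trmx0 trmx1 -symL0.
Qed.

(** By block-diagonality the form is the [L0]-form of the upper half plus the sum of squares of the
    lower half. *)
Lemma Lh_psd : nonneg_qform L0 -> nonneg_qform (Lh L0).
Proof.
move=> psdL0 x; rewrite -(vsubmxK x) /qform /Lh tr_col_mx mul_row_block.
rewrite !mulmx0 addr0 add0r mulmx1 mul_row_col mxE addr_ge0 //.
  exact: psdL0.
by rewrite mxE sumr_ge0 // => i _; rewrite mxE -expr2 sqr_ge0.
Qed.

End LhFacts.

(** The mobility is evaluated at the extrapolated state, which involves only [an] and [aprev], so
    [K] is constant in the unknown. *)
Lemma bdf2_linear (R : realType) (N r : nat) (L0 Ga Gs : 'M[R]_N) (g : R -> R)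
    (Uphi Uq : 'M[R]_(N, r)) (dt : R) (aprev an : 'cV[R]_(r + r)) :
  linear_system (bdf2_lhs L0 Uphi Uq dt aprev an)
                (bdf2_rhs L0 Ga Gs g Uphi Uq aprev an).
Proof.
rewrite /bdf2_lhs /bdf2_rhs /=.
set M := _ *m basis _ _; set K := _ *m Nh _ _ _ _; set c := (2 * dt)^-1.
(* The matrix collects the implicit part of the difference quotient and the flux moved to the left;
   the vector holds the two known time levels. *)
exists ((c * 3) *: M + K *m Lh L0 *m basis Uphi Uq).
exists (M *m (c *: (4 *: an - aprev))) => x.
rewrite opprK mulmxDl -scalemxAl !mulmxA -!scalemxAr !mulmxDr !mulmxN.
rewrite -!scalemxAr !scalerDr !scalerN !scalerA opprB.
by rewrite [RHS]addrAC [X in _ = _ + X + _]addrC !addrA.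
Qed.

Theorem theorem4p2 (R : realType) (N r : nat)
    (hN : (1 <= N)%N) (hr : (1 <= r <= N)%N)
    (L0 Ga Gs : 'M[R]_N) (g : R -> R) (Uphi Uq : 'M[R]_(N, r))
    (L0_sym : L0 \is symmetricmx) (L0_psd : nonneg_qform L0)
    (L0_inv : L0 \in unitmx)
    (Ga_skew : Ga \is skewmx)
    (Gs_sym : Gs \is symmetricmx) (Gs_psd : nonneg_qform Gs)
    (Uphi_orth : Uphi^T *m Uphi = 1%:M) (Uq_orth : Uq^T *m Uq = 1%:M)
    (dt : R) (dt_gt0 : 0 < dt) (aprev an : 'cV[R]_(r + r)) :
  linear_system (bdf2_lhs L0 Uphi Uq dt aprev an)
                (bdf2_rhs L0 Ga Gs g Uphi Uq aprev an)
  /\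
  forall anext : 'cV[R]_(r + r),
    bdf2_lhs L0 Uphi Uq dt aprev an anext
      = bdf2_rhs L0 Ga Gs g Uphi Uq aprev an anext ->
    let U := basis Uphi Uq in
    bdf2_energy L0 Uphi Uq anext an - bdf2_energy L0 Uphi Uq an aprev
      <= - dt * qform (Nh g Ga Gs (U *m extrapolate an aprev))
                      (Lh L0 *m (U *m anext)).
Proof.
split; first exact: bdf2_linear.
move=> anext scheme /=; rewrite /bdf2_energy /=; set U := basis Uphi Uq.
have symL := Lh_sym L0_sym.
have tested : bform (Lh L0) (U *m anext)
    (3 *: (U *m anext) - 4 *: (U *m an) + U *m aprev)
  = - (2 * dt) * qform (Nh g Ga Gs (U *m extrapolate an aprev))
                   (Lh L0 *m (U *m anext)).
  (* Pairing with [anext] turns [anext^T *m U^T *m (Lh L0)^T] into the transpose of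
     [Lh L0 *m (U *m anext)], so the right side becomes the dissipation; the factor [2 * dt] clears
     the quotient. *)
  have := congr1 (fun w => (2 * dt) * (anext^T *m w) 0 0) scheme.
  have dt_neq0 : 2 * dt != 0 by rewrite mulf_neq0 ?pnatr_eq0 ?gt_eqF.
  rewrite /bdf2_lhs /bdf2_rhs /= -/U -!scalemxAr mulmxN.
  rewrite [X in _ * X = _]mxE mulVKf // [X in _ = _ * X]mxE mulrN -mulNr.
  rewrite /bform /qform !trmx_mul symL !mulmxA => <-.
  by rewrite -!mulmxA [U *m _ in RHS]mulmxDr mulmxBr -!scalemxAr.
set Q := qform (Nh _ _ _ _) _ in tested *.
rewrite !mulmxBr -!scalemxAr (bdf2_polarization symL) tested.
(* With [Q] folded, the only [qform] left is that of the second difference. The energy increment now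
   reads [- dt * Q - D / 4], so [0 <= D] suffices. *)
set D := qform _ _.
have D_ge0 : 0 <= D by exact: Lh_psd.
by lra.
Qed.
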